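(* Let $k\ge3$, let $W_{3k+1}$ be the squared cycle graph on $3k+1$ vertices, and let $H_k$ be its induced $k$-independent graph. Then $H_k$ is $(k+2)$-regular, and the neighborhood complex $\mathcal{N}(H_k)$ is $(k+1)$-dimensional and homotopy equivalent to $\mathbb{S}^1$.
   Context: The squared cycle graph $W_n$ has vertex set $[n]=\{1,\dots,n\}$ and edges $\{i,i+1 \bmod n\}$ and $\{i,i+2\bmod n\}$ for $i=1,\dots,n$. For a graph $G$, its induced $k$-independent graph $H_k$ has as vertices the independent sets of size $k$ in $G$, two being adjacent iff they are disjoint. The neighborhood complex $\mathcal{N}(H)$ of a graph $H$ is the simplicial complex on its vertex set whose simplices are the sets of vertices having a common neighbor. *)

(* Defs.v *)
From HB Require Import structures.
From mathcomp Require Import all_boot all_order all_algebra.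
From mathcomp Require Import all_classical all_reals all_analysis.

Set Implicit Arguments.
Unset Strict Implicit.
Unset Printing Implicit Defensive.

Import Order.TTheory GRing.Theory Num.Theory.
Import numFieldNormedType.Exports.

Local Open Scope classical_set_scope.
Local Open Scope ring_scope.

Record sgraph := SGraph {
  vertex :> finType;
  adj : rel vertex;
  adj_sym : symmetric adj;
  adj_irr : irreflexive adj }.

Definition regular (G : sgraph) (d : nat) :=
  forall v : G, #|[pred w | adj v w]| = d.

Definition independent (G : sgraph) (S : {set G}) : bool :=
  [forall u in S, forall v in S, ~~ adj u v].

(* Vertices are residues modulo n. The clause [i != j] only matters for
   n <= 2, where the formula would otherwise produce loops. *)
Section SquaredCycle.
Variable n : nat.

Definition squared_cycle_adj : rel 'I_n := fun i j =>
  (i != j) &&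
  [|| ((i + 1) %% n == j)%N, ((i + 2) %% n == j)%N,
      ((j + 1) %% n == i)%N | ((j + 2) %% n == i)%N].

Lemma squared_cycle_adj_sym : symmetric squared_cycle_adj.
Proof.
move=> i j; rewrite /squared_cycle_adj eq_sym; congr (_ && _).
by do 4 case: (_ == _).
Qed.

Lemma squared_cycle_adj_irr : irreflexive squared_cycle_adj.
Proof. by move=> i; rewrite /squared_cycle_adj eqxx. Qed.

Definition squared_cycle : sgraph :=
  SGraph squared_cycle_adj_sym squared_cycle_adj_irr.

End SquaredCycle.

(* As for the squared cycle, [u != v] only matters for k = 0. *)
Section InducedIndependentGraph.
Variables (G : sgraph) (k : nat).

Definition kindep : finType :=
  {S : {set G} | independent S && (#|S| == k)}.

Definition kindep_adj : rel kindep := fun u v =>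
  (u != v) && [disjoint val u & val v].

Lemma kindep_adj_sym : symmetric kindep_adj.
Proof. by move=> u v; rewrite /kindep_adj eq_sym disjoint_sym. Qed.

Lemma kindep_adj_irr : irreflexive kindep_adj.
Proof. by move=> u; rewrite /kindep_adj eqxx. Qed.

Definition induced_indep_graph : sgraph :=
  SGraph kindep_adj_sym kindep_adj_irr.

End InducedIndependentGraph.

(* The empty simplex is allowed, and elements of V need not be vertices of
   the complex. *)
Record scomplex (V : finType) := SComplex {
  simplices : {set {set V}};
  simplices_closed : forall A B : {set V},
    B \subset A -> A \in simplices -> B \in simplices }.

(* The dimension is -1 for a complex with no nonempty simplex. *)
Definition sc_dim (V : finType) (K : scomplex V) : int :=
  (\max_(A in simplices K) #|A|)%N%:Z - 1.

Section NeighborhoodComplex.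
Variable H : sgraph.

Definition nbh_simplices : {set {set H}} :=
  finset (fun A : {set H} => [exists w : H, [forall v in A, adj w v]]).

Lemma nbh_simplices_closed (A B : {set H}) :
  B \subset A -> A \in nbh_simplices -> B \in nbh_simplices.
Proof.
move=> /fintype.subsetP BA; rewrite !finset.inE => /existsP[w /forall_inP Aw].
by apply/existsP; exists w; apply/forall_inP => v /BA /Aw.
Qed.

Definition neighborhood_complex : scomplex H :=
  SComplex nbh_simplices_closed.

End NeighborhoodComplex.

(* Barycentric coordinates; [{ptws V -> R}] is R^V with the product topology,
   which is the Euclidean one since V is finite. *)
Definition barycentric (R : realType) (V : finType) (K : scomplex V) :
    set {ptws V -> R} :=
  [set x : {ptws V -> R} |
    [/\ forall v, 0 <= x v,
        \sum_(v : V) x v = 1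
      & finset (fun v : V => x v != 0) \in simplices K]].

(* [set_type A] carries the topology induced on A by the ambient space. *)
Definition geom_realization (R : realType) (V : finType) (K : scomplex V) :
  topologicalType := set_type (@barycentric R V K).
Arguments geom_realization R {V} K.

Definition circle (R : realType) : topologicalType :=
  set_type [set p : (R * R)%type | p.1 ^+ 2 + p.2 ^+ 2 = 1].

Definition homotopic (R : realType) (X Y : topologicalType) (f g : X -> Y) :=
  exists h : X * R -> Y,
    [/\ {within [set: X] `*` `[0%R, 1%R], continuous h},
        forall x, h (x, 0) = f x
      & forall x, h (x, 1) = g x].

Definition homotopy_equivalent (R : realType) (X Y : topologicalType) :=
  exists (f : X -> Y) (g : Y -> X),
    [/\ continuous f, continuous g,
        homotopic R (g \o f) idfun & homotopic R (f \o g) idfun].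

(* Main.v *)
(** In Z/(3k+1) the windows of three consecutive vertices force an independent
    set of size k to be 3w, 3(w+1), ..., 3(w+k-1) for a unique w. Two such sets
    are disjoint exactly when their parameters differ by k, ..., 2k+1, so the
    graph is (k+2)-regular and the simplices of the neighborhood complex are the
    sets of parameters contained in an arc of k+2 consecutive residues.

    Such an arc spans less than half of the circle. Send a point of the
    realization to the normalized barycenter of the (3k+1)-th roots of unity, and
    a point z of the circle to the weights that charge root v by how far z lies
    inside the open cone between roots v-1 and v+1. Both composites are joined to
    the identity by straight lines: a barycenter only charges roots in every arc
    that contains its support, and z has a positive inner product with every root
    that it charges. *)

Require Import Defs.
From mathcomp Require Import all_boot all_order all_algebra.
From mathcomp Require Import all_classical all_reals all_analysis.
From mathcomp Require Import zify ring lra.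

Set Implicit Arguments.
Unset Strict Implicit.
Unset Printing Implicit Defensive.

Import Order.TTheory GRing.Theory Num.Theory.
Import numFieldNormedType.Exports.

(** * Residues modulo n and sums of periodic functions *)

Lemma eqmod_gap (n x y : nat) : (0 < n)%N ->
  exists2 d, (d < n)%N & (y = x + d %[mod n])%N.
Proof.
(* As [n - 1] is -1 modulo [n], the term [x * (n - 1)] stands for -x without truncated
   subtraction. *)
move=> n0; exists ((y + x * (n - 1)) %% n)%N; first exact: ltn_pmod.
rewrite modnDmr addnCA -[X in (_ + (X + _))%N]muln1 -mulnDr subnKC //.
by rewrite addnC modnMDl.
Qed.

Lemma sum_shift1 (n : nat) (F : nat -> nat) : (forall x, F (x + n) = F x)%N ->
  (\sum_(i < n) F (i + 1) = \sum_(i < n) F i)%N.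
Proof.
move=> Fn; case: n Fn => [|n] Fn; first by rewrite !big_ord0.
rewrite [RHS]big_ord_recl [LHS]big_ord_recr /= addnC; congr (_ + _)%N.
  by rewrite addn1 -[n.+1]add0n Fn.
by apply: eq_bigr => i _; rewrite /bump /= addnC.
Qed.

(** * Independent sets of size k in the squared cycle on 3k+1 vertices *)

Section IndependentSets.
Variable k : nat.
Hypothesis k_ge2 : (2 <= k)%N.
Let n := (3 * k + 1)%N.
Notation G := (squared_cycle (3 * k + 1)).

Let n_gt0 : (0 < n)%N. Proof. by rewrite /n addn1. Qed.

Definition residue (x : nat) : G := Ordinal (ltn_pmod x n_gt0).

Lemma residue_eq x y : (residue x == residue y) = (x == y %[mod n]).
Proof. by []. Qed.

Lemma residueK (i : G) : residue i = i.
Proof. by apply/val_inj; rewrite /= modn_small. Qed.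

(** 3 is invertible modulo 3k+1 with inverse 2k+1, because 3(2k+1) = 2(3k+1) + 1. Questions about
    blocks thus reduce to their parameters. *)
Lemma eqmod_mul3 x y : (3 * x == 3 * y %[mod n])%N = (x == y %[mod n]).
Proof.
apply/eqP/eqP => [xy|xy]; last by rewrite -modnMmr xy modnMmr.
suff inv z : (z = (2 * k + 1) * (3 * z) %[mod n])%N.
  by rewrite inv -modnMmr xy modnMmr -inv.
have -> : ((2 * k + 1) * (3 * z) = z + (2 * z) * n)%N by rewrite /n; lia.
by rewrite addnC modnMDl.
Qed.

Lemma adj_residue x y : (x == y + 1 %[mod n]) || (x == y + 2 %[mod n]) ->
  adj (residue x) (residue y).
Proof.
move=> xy; rewrite /= /squared_cycle_adj residue_eq /= !modnDml.
have no c : (0 < c < n)%N -> (x == y + c %[mod n])%N -> x != y %[mod n].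
  move=> /andP[c0 cn] /eqP ->; rewrite -{2}[y]addn0 eqn_modDl mod0n modn_small //.
  by case: c c0 cn.
case/orP: xy => xy; rewrite (eqP xy) eqxx ?orbT andbT.
  by rewrite -(eqP xy) (no 1%N) // /n; lia.
by rewrite -(eqP xy) (no 2%N) // /n; lia.
Qed.

Lemma adj_residueE x y : adj (residue x) (residue y) ->
  [\/ x + 1 = y %[mod n], x + 2 = y %[mod n],
      y + 1 = x %[mod n] | y + 2 = x %[mod n]]%N.
Proof.
rewrite /= /squared_cycle_adj /= !modnDml => /andP[_].
by case/or4P => /eqP; [constructor 1|constructor 2|constructor 3|constructor 4].
Qed.

Definition block (w : nat) : {set G} := [set residue (3 * (w + j))%N | j : 'I_k].

Lemma card_block w : #|block w| = k.
Proof.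
rewrite card_imset ?card_ord // => i j /eqP.
rewrite residue_eq eqmod_mul3 eqn_modDl !modn_small; last 2 first.
- by rewrite /n; have := ltn_ord j; lia.
- by rewrite /n; have := ltn_ord i; lia.
by move/eqP/val_inj.
Qed.

(** Division by 3 turns the adjacency steps 1 and 2 into parameter steps 2k+1 and k+1. Both lie
    between k and n-k, whereas two parameters of one block differ by less than k. *)
Lemma independent_block w : independent (block w).
Proof.
have step (i j : 'I_k) c d : (c = 3 * d %[mod n])%N ->
  (k <= d)%N -> (d + k <= n)%N ->
  (3 * (w + i) + c = 3 * (w + j) %[mod n])%N -> False.
  move=> cd kd dk; rewrite -modnDmr cd modnDmr -mulnDr => /eqP.
  rewrite eqmod_mul3 -addnA eqn_modDl !modn_small; first last.
  - by have := ltn_ord i; lia.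
  - by have := ltn_ord j; lia.
  by have := ltn_ord j; lia.
have c1 : (1 = 3 * (2 * k + 1) %[mod n])%N.
  have -> : (3 * (2 * k + 1) = 2 * n + 1)%N by rewrite /n; lia.
  by rewrite modnMDl.
have c2 : (2 = 3 * (k + 1) %[mod n])%N.
  have -> : (3 * (k + 1) = 1 * n + 2)%N by rewrite /n; lia.
  by rewrite modnMDl.
apply/forall_inP => _ /imsetP[i _ ->]; apply/forall_inP => _ /imsetP[j _ ->].
apply/negP => /adj_residueE[] e.
- by apply: (step _ _ _ _ c1 _ _ e); rewrite /n; lia.
- by apply: (step _ _ _ _ c2 _ _ e); rewrite /n; lia.
- by apply: (step _ _ _ _ c1 _ _ e); rewrite /n; lia.
- by apply: (step _ _ _ _ c2 _ _ e); rewrite /n; lia.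
Qed.

(* A window of three consecutive vertices meets an independent set S at most
   once, and the 3k+1 windows meet it 3k times in total, so exactly one of them
   misses S; from that window on, S advances by steps of 3. *)
Lemma independent_blockE (S : {set G}) : independent S -> #|S| = k ->
  exists w, S = block w.
Proof.
move=> indS cardS; pose P x := residue x \in S.
have Pmod x y : (x = y %[mod n])%N -> P x = P y.
  by move=> /eqP; rewrite -residue_eq /P => /eqP ->.
have Pn x : P (x + n)%N = P x by apply: Pmod; rewrite modnDr.
have P1 x c : (0 < c < 3)%N -> P x -> P (x + c)%N -> False.
  move=> c12 Px Pc; move/forall_inP: indS => /(_ _ Pc)/forall_inP/(_ _ Px)/negP.
  apply; apply: adj_residue; move: c12; case: c {Pc} => [|[|[|c]]] //= _.
    by rewrite eqxx.
  by rewrite eqxx orbT.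
(* Each of the three positions in a window runs through all residues, so it meets S exactly k
   times. *)
have sP c : (\sum_(i < n) P (i + c)%N = k)%N.
  elim: c => [|c IH].
    under eq_bigr do rewrite addn0 /P residueK.
    by rewrite -[RHS]cardS -sum1_card [RHS]big_mkcond.
  rewrite -[RHS]IH -(sum_shift1 (F := fun x => P (x + c)%N)) => [|x].
    by apply: eq_bigr => i _; congr (nat_of_bool (P _)); lia.
  by rewrite addnAC Pn.
pose Q x := (P x || P (x + 1)%N || P (x + 2)%N).
have sQ : (\sum_(i < n) Q i = 3 * k)%N.
  have -> : (3 * k = k + k + k)%N by lia.
  rewrite -{1}(sP 0%N) -{1}(sP 1%N) -(sP 2%N) -!big_split /=.
  apply: eq_bigr => i _; rewrite addn0 /Q.
  have h1 := @P1 i 1%N isT; have h2 := @P1 i 2%N isT.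
  have := @P1 (i + 1)%N 1%N isT; rewrite -addnA.
  by case: (P i) h1 h2 => h1 h2; case: (P _) h1 => h1; case: (P _) h2 => h2 h3 //;
     exfalso; auto.
have sQ1 : (\sum_(i < n) ~~ Q i = 1)%N.
  apply: (@addnI (3 * k)%N); rewrite -{1}sQ -big_split /=.
  transitivity (\sum_(i < n) 1)%N; last by rewrite sum1_card card_ord.
  by apply: eq_bigr => i _; case: (Q i).
have Qmod x y : (x = y %[mod n])%N -> Q x = Q y.
  move=> xy; rewrite /Q (Pmod x y) // (Pmod (x + 1) (y + 1))%N.
    by rewrite (Pmod (x + 2) (y + 2))%N // -modnDml xy modnDml.
  by rewrite -modnDml xy modnDml.
have [u Qu] : exists u : 'I_n, ~~ Q u.
  apply/existsP; apply: contra_eqT sQ1; rewrite negb_exists => /forallP h.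
  by rewrite big1 // => i _; have := h i; rewrite negbK => ->.
have Qv v : (v != u %[mod n])%N -> Q v.
  move=> vu; apply: contra_eqT sQ1 => Qv.
  have vn := ltn_pmod v n_gt0; pose v' := Ordinal vn.
  have v'u : v' != u by apply: contraNneq vu => <-; rewrite /= modn_mod.
  rewrite (bigD1 u) //= (bigD1 v') //= Qu (Qmod _ v) ?modn_mod // Qv.
  by rewrite addnA.
move: (Qu); rewrite /Q !negb_or => /andP[/andP[Pu Pu1] Pu2].
(* The window at x+1 meets S, but x+1 and x+2 are too close to x. *)
have next x : P x -> (x + 1 != u %[mod n])%N -> P (x + 3)%N.
  move=> Px /Qv; rewrite /Q -!addnA => /orP[/orP[]|//] h.
    by case: (@P1 x 1%N).
  by case: (@P1 x 2%N).
have neq c : (0 < c < n)%N -> (u + c != u %[mod n])%N.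
  by move=> cn; rewrite -[X in _ != X %[mod n]]addn0 eqn_modDl mod0n modn_small; lia.
have start : P (u + 3)%N.
  have := Qv _ (neq 1%N _); rewrite /Q -!addnA (negbTE Pu1) (negbTE Pu2) /=; apply.
  by rewrite /n; lia.
have Pj j : (j < k)%N -> P (u + 3 + 3 * j)%N.
  elim: j => [|j IH] jk; first by rewrite muln0 addn0.
  have -> : (u + 3 + 3 * j.+1 = u + 3 + 3 * j + 3)%N by lia.
  apply: next; first by apply: IH; lia.
  have -> : (u + 3 + 3 * j + 1 = u + (3 * j + 4))%N by lia.
  by apply: neq; rewrite /n; lia.
(* The factor 2k+1 divides by 3, so the block starts at u+3, the first vertex after the missed
   window u, u+1, u+2. *)
exists ((2 * k + 1) * (u + 3))%N; apply/esym/eqP.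
rewrite eqEcard card_block cardS leqnn andbT.
apply/fintype.subsetP => _ /imsetP[j _ ->].
have := Pj j (ltn_ord j); rewrite -(Pmod (3 * ((2 * k + 1) * (u + 3) + j)))%N //.
have -> : (3 * ((2 * k + 1) * (u + 3) + j) =
  (2 * (u + 3)) * n + (u + 3 + 3 * j))%N by rewrite /n; lia.
by rewrite modnMDl.
Qed.

(** After division by 3 the blocks are arcs of k consecutive residues starting at w and w+d. They
    are disjoint when each start lies past the end of the other arc: k <= d and k <= n-d. *)
Lemma disjoint_block w d : (d < n)%N ->
  [disjoint block w & block (w + d)%N] = (k <= d < 2 * k + 2)%N.
Proof.
move=> dn; apply/idP/idP => [|dk].
  apply: contraTT => dk; apply/pred0Pn.
  case: (ltnP d k) => kd.
    have k0 : (0 < k)%N by lia.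
    exists (residue (3 * (w + d))%N); rewrite !inE; apply/andP; split.
      by apply/imsetP; exists (Ordinal kd).
    by apply/imsetP; exists (Ordinal k0) => //=; rewrite addn0.
  have ndk : (n - d < k)%N by rewrite /n in dn *; lia.
  have k0 : (0 < k)%N by lia.
  exists (residue (3 * w)%N); rewrite !inE; apply/andP; split.
    by apply/imsetP; exists (Ordinal k0) => //=; rewrite addn0.
  apply/imsetP; exists (Ordinal ndk) => //=; apply/eqP.
  by rewrite residue_eq eqmod_mul3 -addnA subnKC 1?ltnW // modnDr.
apply/pred0Pn => -[x] /= /andP[/imsetP[i _ ->] /imsetP[j _ /eqP]].
rewrite residue_eq eqmod_mul3 -addnA eqn_modDl !modn_small.
- by have := ltn_ord i; lia.
- by have := ltn_ord j; rewrite /n; lia.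
- by have := ltn_ord i; rewrite /n; lia.
Qed.

Definition iset (w : 'I_n) : induced_indep_graph G k :=
  exist _ (block w) (introT andP
    (conj (independent_block w) (introT eqP (card_block w)))).

Lemma block_eqmod v w : (v = w %[mod n])%N -> block v = block w.
Proof.
move=> vw; apply: eq_imset => j; apply/eqP.
by rewrite residue_eq eqmod_mul3 -modnDml vw modnDml.
Qed.

(** For d < k the block at w+k tells the two apart: it is disjoint from [block w] but meets
    [block (w + d)]. For larger d the two blocks are themselves disjoint and nonempty. *)
Lemma block_shift_neq w d : (0 < d < 2 * k + 2)%N -> block w != block (w + d)%N.
Proof.
move=> /andP[d0 d2k]; apply/eqP => wd.
case: (ltnP d k) => dk.
  have := @disjoint_block w k; have := @disjoint_block (w + d) (k - d).
  by rewrite -wd -addnA subnKC 1?ltnW // /n; lia.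
have := @disjoint_block w d; rewrite -wd -setI_eq0 finset.setIid -cards_eq0 card_block.
rewrite /n; lia.
Qed.

Lemma iset_inj : injective iset.
Proof.
move=> v w /(congr1 val) /= vw; apply/val_inj.
have [d dn wd] := eqmod_gap v w n_gt0; have vd := block_eqmod wd.
case: (posnP d) => [d0|d0]; first by move: wd; rewrite d0 addn0 !modn_small.
case: (ltnP d (2 * k + 2)) => dk.
  have /negP[] : block v != block (v + d)%N by apply: block_shift_neq; rewrite d0.
  by rewrite -vd vw.
(* A gap of 2k+2 or more becomes short when measured the other way round, from v+d to v+n. *)
have /negP[] : block (v + d)%N != block (v + d + (n - d))%N.
  by apply: block_shift_neq; rewrite /n in dn *; lia.
rewrite -addnA subnKC 1?ltnW // -vd -vw; apply/eqP/block_eqmod.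
by rewrite modnDr.
Qed.

Lemma iset_surj v : exists w, iset w = v.
Proof.
case: v => S p; case/andP: (p) => indS /eqP cardS.
have [w Sw] := independent_blockE indS cardS.
exists (residue w); apply/val_inj; rewrite /= Sw.
by apply: block_eqmod; rewrite modn_mod.
Qed.

(** Writing the gap as k + l exhibits the neighborhood of v as the arc of k+2 residues starting at
    v+k. *)
Lemma adj_iset (v w : 'I_n) : adj (iset v) (iset w) <->
  (exists2 l, l < k + 2 & w = v + (k + l) %[mod n])%N.
Proof.
have [d dn wd] := eqmod_gap v w n_gt0.
have dE : [disjoint block v & block w] = (k <= d < 2 * k + 2)%N.
  by rewrite -(disjoint_block v dn) -(block_eqmod wd).
have -> : adj (iset v) (iset w) = (k <= d < 2 * k + 2)%N.
  rewrite /= /kindep_adj /= dE andb_idl // -dE => dis.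
  apply: contraTneq dis => /(congr1 val) /= <-.
  by rewrite -setI_eq0 finset.setIid -cards_eq0 card_block; lia.
split=> [dk|[l lk wl]].
  by exists (d - k)%N; [lia|rewrite subnKC //; lia].
move/eqP: wd; rewrite wl eqn_modDl !modn_small // /n; lia.
Qed.

End IndependentSets.

Local Open Scope classical_set_scope.
Local Open Scope ring_scope.

(** * Continuity of maps to the line, the plane, function spaces and subspaces *)

Section Continuity.
Variables (R : realType) (X : topologicalType).
Implicit Types f g : X -> R.

Lemma ctsD f g : continuous f -> continuous g -> continuous (fun x => f x + g x).
Proof. by move=> cf cg x; apply: cvgD; [exact: cf|exact: cg]. Qed.

Lemma ctsB f g : continuous f -> continuous g -> continuous (fun x => f x - g x).
Proof. by move=> cf cg x; apply: cvgB; [exact: cf|exact: cg]. Qed.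

Lemma ctsM f g : continuous f -> continuous g -> continuous (fun x => f x * g x).
Proof. by move=> cf cg x; apply: cvgM; [exact: cf|exact: cg]. Qed.

Lemma ctsV f : continuous f -> (forall x, f x != 0) ->
  continuous (fun x => (f x)^-1).
Proof. by move=> cf f0 x; apply: cvgV => //; exact: cf. Qed.

Lemma cts_max f g : continuous f -> continuous g ->
  continuous (fun x => Num.max (f x) (g x)).
Proof. by move=> cf cg x; apply: continuous_max; [exact: cf|exact: cg]. Qed.

Lemma cts_min f g : continuous f -> continuous g ->
  continuous (fun x => Num.min (f x) (g x)).
Proof. by move=> cf cg x; apply: continuous_min; [exact: cf|exact: cg]. Qed.

Lemma cts_sum (I : finType) (F : I -> X -> R) :
  (forall i, continuous (F i)) -> continuous (fun x => \sum_i F i x).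
Proof.
move=> cF; elim: (index_enum I) => [|i s IH].
  have -> : (fun x => \sum_(i <- [::]) F i x) = fun=> 0.
    by apply/funext => x; rewrite big_nil.
  by move=> x; exact: cvg_cst.
have -> : (fun x => \sum_(j <- i :: s) F j x) =
          (fun x => F i x + \sum_(j <- s) F j x).
  by apply/funext => x; rewrite big_cons.
exact: ctsD.
Qed.

Lemma cts_pair f g : continuous f -> continuous g ->
  continuous (fun x => (f x, g x) : R * R).
Proof. by move=> cf cg x; exact: (cvg_pair (cf x) (cg x)). Qed.

Lemma cts_fst (F : X -> R * R) : continuous F -> continuous (fun x => (F x).1).
Proof. by move=> cF x; apply: (cvg_comp _ _ (cF x)); exact: cvg_fst. Qed.

Lemma cts_snd (F : X -> R * R) : continuous F -> continuous (fun x => (F x).2).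
Proof. by move=> cF x; apply: (cvg_comp _ _ (cF x)); exact: cvg_snd. Qed.

Lemma cts_ptws (V : finType) (F : X -> {ptws V -> R}) :
  (forall v, continuous (fun x => F x v)) -> continuous F.
Proof.
move=> cF x; apply/cvg_sup => v.
exact: (@continuous_comp_initial _ _ _ (fun f : V -> R => f v) F (cF v) x).
Qed.

Lemma cts_eval (V : finType) (F : X -> {ptws V -> R}) v :
  continuous F -> continuous (fun x => F x v).
Proof.
move=> cF x; apply: (@continuous_comp X {ptws V -> R} R F (@proj V (fun=> R) v)).
  exact: cF.
exact: proj_continuous.
Qed.

End Continuity.

Section SubspaceMaps.
Variables (X E : topologicalType) (A : set E).

Lemma cts_val (f : X -> set_type A) : continuous f -> continuous (fun x => val (f x)).
Proof.
move=> cf x; apply: (cvg_comp _ _ (cf x)).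
by have := @initial_continuous (set_type A) E set_val (f x); rewrite set_valE.
Qed.

Lemma lift_set_type (F : X -> E) : continuous F -> (forall x, A (F x)) ->
  exists2 f : X -> set_type A, continuous f & forall x, val (f x) = F x.
Proof.
move=> cF AF; exists (fun x => exist _ (F x) (mem_set (AF x))) => //.
by apply: continuous_comp_initial; rewrite set_valE.
Qed.

End SubspaceMaps.

(** * Homotopies in subspaces and in geometric realizations *)

Definition clamp (R : realType) (t : R) := Num.max 0 (Num.min 1 t).

Lemma clamp_itv (R : realType) (t : R) : 0 <= clamp t <= 1.
Proof. by rewrite /clamp le_max lexx /= ge_max ler01 ge_min lexx. Qed.

Lemma clamp0 (R : realType) : clamp (0 : R) = 0.
Proof. by rewrite /clamp min_r ?ler01 // maxxx. Qed.

Lemma clamp1 (R : realType) : clamp (1 : R) = 1.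
Proof. by rewrite /clamp minxx max_r ?ler01. Qed.

(** [H] stays in [A] only for times in [0, 1], while a homotopy is a map on all of [X * R].
    Truncating time with [clamp] makes it total and changes neither end. *)
Lemma homotopic_set_type (R : realType) (X E : topologicalType) (A : set E)
    (f g : X -> set_type A) (H : X -> R -> E) :
  continuous (fun q : X * R => H q.1 (clamp q.2)) ->
  (forall x t, 0 <= t <= 1 -> A (H x t)) ->
  (forall x, H x 0 = val (f x)) -> (forall x, H x 1 = val (g x)) ->
  homotopic R f g.
Proof.
move=> cH AH H0 H1.
have [h ch hE] := lift_set_type cH (fun q => AH q.1 _ (clamp_itv q.2)).
exists h; split; first exact: continuous_subspaceT.
  by move=> x; apply/val_inj; rewrite hE /= clamp0.
by move=> x; apply/val_inj; rewrite hE /= clamp1.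
Qed.

Section ProductMaps.
Variables (R : realType) (X : topologicalType).

Lemma cts_clamp : continuous (fun q : X * R => clamp q.2).
Proof.
apply: cts_max; first by move=> q; exact: cvg_cst.
apply: cts_min; first by move=> q; exact: cvg_cst.
by move=> q; exact: cvg_snd.
Qed.

Lemma cts_comp_fst (Y : topologicalType) (f : X -> Y) :
  continuous f -> continuous (fun q : X * R => f q.1).
Proof.
by move=> cf q; apply: (@continuous_comp (X * R)%type X Y fst f);
  [exact: cvg_fst|exact: cf].
Qed.

End ProductMaps.

(** On the segment from [f x] to [g x] the support stays in the union of the two supports, so the
    segment lies in one closed simplex. *)
Lemma homotopic_realization (R : realType) (X : topologicalType) (V : finType)
    (K : scomplex V) (f g : X -> geom_realization R K) :
  continuous f -> continuous g ->
  (forall x, [set v | (val (f x) v != 0) || (val (g x) v != 0)]%SET \in simplices K) ->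
  homotopic R f g.
Proof.
move=> cf cg fgK.
apply: (@homotopic_set_type R X _ _ f g
  (fun x t v => (1 - t) * val (f x) v + t * val (g x) v)).
- apply: cts_ptws => v; apply: ctsD; apply: ctsM; try exact: cts_clamp.
  + by apply: ctsB; [move=> q; exact: cvg_cst|exact: cts_clamp].
  + apply: (cts_comp_fst (f := fun x => val (f x) v)).
    by apply: (cts_eval (F := fun x => val (f x))); exact: cts_val.
  + apply: (cts_comp_fst (f := fun x => val (g x) v)).
    by apply: (cts_eval (F := fun x => val (g x))); exact: cts_val.
- move=> x t /andP[t0 t1].
  have [f0 f1 _] := set_valP (f x); have [g0 g1 _] := set_valP (g x).
  split.
  + by move=> v; apply: addr_ge0; apply: mulr_ge0 => //; lra.
  + by rewrite big_split /= -!mulr_sumr f1 g1; lra.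
  + apply: simplices_closed (fgK x); apply/fintype.subsetP => v; rewrite !finset.inE.
    apply: contraR; rewrite negb_or !negbK => /andP[/eqP-> /eqP->].
    by rewrite !mulr0 addr0.
- by move=> x; apply/funext => v; rewrite subr0 mul1r mul0r addr0.
- by move=> x; apply/funext => v; rewrite subrr mul1r mul0r add0r.
Qed.

(** * Determinants, inner products and normalization in the plane *)

Section Plane.
Variable R : realType.
Implicit Types z w u : (R * R)%type.

Definition det z w := z.1 * w.2 - z.2 * w.1.
Definition dot z w := z.1 * w.1 + z.2 * w.2.
Definition unitv z : R * R :=
  (z.1 / Num.sqrt (dot z z), z.2 / Num.sqrt (dot z z)).

Lemma dot_gt0 z : z != 0 -> 0 < dot z z.
Proof.
case: z => a b; rewrite /dot /= => ab0; rewrite lt_neqAle addr_ge0 -?expr2 ?sqr_ge0 //.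
rewrite andbT eq_sym paddr_eq0 ?sqr_ge0 // !sqrf_eq0.
by apply: contra ab0 => /andP[/eqP-> /eqP->].
Qed.

Lemma norm_gt0 z : z != 0 -> 0 < Num.sqrt (dot z z).
Proof. by move=> /dot_gt0; rewrite sqrtr_gt0. Qed.

Lemma unitv_circle z : z != 0 -> (unitv z).1 ^+ 2 + (unitv z).2 ^+ 2 = 1.
Proof.
move=> z0; rewrite /unitv /= !expr_div_n sqr_sqrtr ?ltW ?dot_gt0 //.
by rewrite -mulrDl !expr2 -/(dot z z) divff // gt_eqF // dot_gt0.
Qed.

Lemma unitv_id z : z.1 ^+ 2 + z.2 ^+ 2 = 1 -> unitv z = z.
Proof.
case: z => a b; rewrite /unitv /dot -!expr2 /= => ->.
by rewrite sqrtr1 !divr1.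
Qed.

Lemma dot_unitv z w : dot (unitv z) w = dot z w / Num.sqrt (dot z z).
Proof. by rewrite /dot /unitv /= -/(dot z z); ring. Qed.

Lemma det_unitv z w : det (unitv z) w = det z w / Num.sqrt (dot z z).
Proof. by rewrite /det /unitv /= -/(dot z z); ring. Qed.

Lemma detC z w : det z w = - det w z.
Proof. by rewrite /det; ring. Qed.

(** Cramer's rule for z in terms of p and q, paired with u by the determinant. *)
Lemma det_pluecker u z p q :
  det u z * det p q = det u p * det z q + det u q * det p z.
Proof. by rewrite /det; ring. Qed.

Lemma cts_unitv (X : topologicalType) (F : X -> R * R) :
  continuous F -> (forall x, F x != 0) -> continuous (fun x => unitv (F x)).
Proof.
move=> cF F0.
have cV : continuous (fun x => (Num.sqrt (dot (F x) (F x)))^-1).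
  apply: ctsV => [|x]; last by rewrite gt_eqF // norm_gt0.
  move=> x; apply: (@cvg_comp _ _ _ (fun x => dot (F x) (F x))).
    apply: (ctsD (f := fun x => (F x).1 * (F x).1)).
      by apply: ctsM; exact: cts_fst.
    by apply: ctsM; exact: cts_snd.
  exact: sqrt_continuous.
by apply: cts_pair; apply: ctsM => //; [exact: cts_fst|exact: cts_snd].
Qed.

(** Points with positive inner product are not antipodal, so the segment between them misses the
    origin and can be normalized. *)
Lemma homotopic_circle (X : topologicalType) (f g : X -> circle R) :
  continuous f -> continuous g -> (forall x, 0 < dot (val (f x)) (val (g x))) ->
  homotopic R f g.
Proof.
move=> cf cg fg.
pose L x (t : R) : R * R := ((1 - t) * (val (f x)).1 + t * (val (g x)).1,
  (1 - t) * (val (f x)).2 + t * (val (g x)).2).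
have L0 x t : 0 <= t <= 1 -> L x t != 0.
  move=> /andP[t0 t1]; apply/eqP => -[h1 h2].
  have P0 := fg x; set P := dot _ _ in P0.
  have : dot (L x t) (val (f x)) = 0 by rewrite /dot /= h1 h2; ring.
  (* Pairing the segment with [f x] gives (1-t) + tP, which vanishes for no t in [0, 1] since P >
     0. *)
  have -> : dot (L x t) (val (f x)) =
      (1 - t) * ((val (f x)).1 ^+ 2 + (val (f x)).2 ^+ 2) + t * P.
    by rewrite /P /L /dot /=; ring.
  rewrite (set_valP (f x)) mulr1 => e; have tP := mulr_ge0 t0 (ltW P0).
  have t1E : t = 1 by lra.
  by move: e; rewrite t1E; lra.
apply: (@homotopic_set_type R X _ _ f g (fun x t => unitv (L x t))).
- apply: cts_unitv => [|q]; last exact/L0/clamp_itv.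
  have c1 : continuous (fun q : X * R => 1 - clamp q.2).
    by apply: ctsB; [move=> q; exact: cvg_cst|exact: cts_clamp].
  apply: cts_pair; apply: ctsD; apply: ctsM => //; try exact: cts_clamp.
  + by apply: (cts_comp_fst (f := fun x => (val (f x)).1));
      apply: (cts_fst (F := fun x => val (f x))); exact: cts_val.
  + by apply: (cts_comp_fst (f := fun x => (val (g x)).1));
      apply: (cts_fst (F := fun x => val (g x))); exact: cts_val.
  + by apply: (cts_comp_fst (f := fun x => (val (f x)).2));
      apply: (cts_snd (F := fun x => val (f x))); exact: cts_val.
  + by apply: (cts_comp_fst (f := fun x => (val (g x)).2));
      apply: (cts_snd (F := fun x => val (g x))); exact: cts_val.
- by move=> x t t01; apply/unitv_circle/L0.
- move=> x; have -> : L x 0 = val (f x).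
    by rewrite /L; case: (val (f x)) => a b; rewrite /=; congr (_, _); ring.
  exact/unitv_id/(set_valP (f x)).
- move=> x; have -> : L x 1 = val (g x).
    by rewrite /L; case: (val (g x)) => a b; rewrite /=; congr (_, _); ring.
  exact/unitv_id/(set_valP (g x)).
Qed.

End Plane.

(** * Roots of unity and the open cones between second neighbors *)

Section RootsOfUnity.
Variables (R : realType) (n : nat).
Hypothesis n_gt4 : (4 < n)%N.

Let n_gt0 : (0 < n)%N. Proof. by lia. Qed.
Let nR_gt0 : 0 < n%:R :> R. Proof. by rewrite ltr0n. Qed.

Definition angle (i : nat) : R := pi * (2 * i)%:R / n%:R.
Definition vtx (i : nat) : R * R := (cos (angle i), sin (angle i)).

Lemma angleD i j : angle (i + j) = angle i + angle j.
Proof. by rewrite /angle mulnDr natrD mulrDr mulrDl. Qed.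

Lemma anglen : angle n = pi *+ 2.
Proof. by rewrite /angle natrM mulrA mulfK ?mulr_natr // gt_eqF. Qed.

Lemma vtxDn i : vtx (i + n) = vtx i.
Proof. by rewrite /vtx angleD anglen cosD2pi sinD2pi. Qed.

Lemma vtx_eqmod i j : (i = j %[mod n])%N -> vtx i = vtx j.
Proof.
suff vm q : vtx q = vtx (q %% n) by move=> ij; rewrite vm ij -vm.
rewrite {1}(divn_eq q n) addnC; elim: (q %/ n)%N => [|a IH]; first by rewrite addn0.
by rewrite mulSnr addnA vtxDn.
Qed.

Lemma det_vtx i d : det (vtx i) (vtx (i + d)) = sin (angle d).
Proof.
have -> : angle d = angle (i + d) - angle i by rewrite angleD; ring.
by rewrite /det /vtx sinB /=; ring.
Qed.

Lemma angle_gt0 d : (0 < d)%N -> 0 < angle d.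
Proof.
move=> d0; apply: divr_gt0 => //; apply: mulr_gt0; last by rewrite ltr0n muln_gt0.
exact: pi_gt0.
Qed.

Lemma angle_ge0 d : 0 <= angle d.
Proof.
by case: d => [|d]; [rewrite /angle muln0 mulr0 mul0r|exact/ltW/angle_gt0].
Qed.

Lemma sin_angle_ge0 d : (2 * d <= n)%N -> 0 <= sin (angle d).
Proof.
move=> dn; apply: sin_ge0_pi; apply/andP; split.
  by rewrite angle_ge0.
by rewrite /angle ler_pdivrMr // ler_pM2l ?pi_gt0 // ler_nat.
Qed.

Lemma sin_angle_gt0 d : (0 < d)%N -> (2 * d < n)%N -> 0 < sin (angle d).
Proof.
move=> d0 dn; apply: sin_gt0_pi; apply/andP; split.
  by rewrite angle_gt0.
by rewrite /angle ltr_pdivrMr // ltr_pM2l ?pi_gt0 // ltr_nat.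
Qed.

Lemma sin_angle_opp d : (d <= n)%N -> sin (angle (n - d)) = - sin (angle d).
Proof.
move=> dn; have : angle (n - d) + angle d = pi *+ 2 by rewrite -angleD subnK // anglen.
by move/(canRL (addrK _)) ->; rewrite addrC sinD2pi sinN.
Qed.

Lemma sin_angle_le0 d : (n <= 2 * d)%N -> (d <= n)%N -> sin (angle d) <= 0.
Proof.
by move=> nd dn; rewrite -oppr_ge0 -sin_angle_opp // sin_angle_ge0 //; lia.
Qed.

Lemma sin_angle_lt0 d : (n < 2 * d)%N -> (d < n)%N -> sin (angle d) < 0.
Proof.
move=> nd dn; rewrite -oppr_gt0 -sin_angle_opp ?sin_angle_gt0 //; lia.
Qed.

(* q + n.-1 stands for the predecessor of q modulo n *)
Definition near_vtx (z : R * R) (q : nat) :=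
  Num.max 0 (Num.min (det (vtx (q + n.-1)) z) (det z (vtx (q + 1)))).

Lemma near_vtx_gt0 z q : (0 < near_vtx z q) =
  (0 < det (vtx (q + n.-1)) z) && (0 < det z (vtx (q + 1))).
Proof. by rewrite /near_vtx lt_max ltxx /= lt_min. Qed.

Lemma near_vtx_ge0 z q : 0 <= near_vtx z q.
Proof. by rewrite /near_vtx le_max lexx. Qed.

(* If z were near a vertex t + j outside the arc, the Pluecker relation would
   write its determinants with the two ends of the arc as positive combinations
   of sines of angles around j and j - m; at one end these have the wrong sign. *)
Lemma near_vtx_arc t m z q : (2 <= m)%N ->
  0 <= det (vtx t) z -> 0 <= det z (vtx (t + m)) -> 0 < near_vtx z q ->
  exists2 l, (l <= m)%N & (q = t + l %[mod n])%N.
Proof.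
move=> m2 tz zm; rewrite near_vtx_gt0 => /andP[qz zq].
have [j jn qj] := eqmod_gap t q n_gt0.
case: (leqP j m) => [jm|mj]; first by exists j.
exfalso.
have e1 : vtx (q + 1) = vtx (t + j.+1).
  by apply: vtx_eqmod; rewrite -modnDml qj modnDml addn1 addnS.
have e0 : vtx (q + n.-1) = vtx (t + j.-1).
  apply: vtx_eqmod; rewrite -modnDml qj modnDml.
  by have -> : (t + j + n.-1 = t + j.-1 + n)%N; [lia|rewrite modnDr].
rewrite e0 e1 in qz zq; clear qj.
have d2 : 0 < det (vtx (t + j.-1)) (vtx (t + j.+1)).
  have -> : (t + j.+1 = t + j.-1 + 2)%N by lia.
  by rewrite det_vtx sin_angle_gt0 //; lia.
have := mulr_ge0 tz (ltW d2); rewrite det_pluecker !det_vtx => lo.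
have := mulr_ge0 zm (ltW d2); rewrite detC mulNr det_pluecker.
rewrite [det (vtx (t + m)) (vtx (t + j.-1))](_ : _ = sin (angle (j.-1 - m))); last first.
  by have -> : (t + j.-1 = t + m + (j.-1 - m))%N; [lia|rewrite det_vtx].
rewrite [det (vtx (t + m)) (vtx (t + j.+1))](_ : _ = sin (angle (j.+1 - m))); last first.
  by have -> : (t + j.+1 = t + m + (j.+1 - m))%N; [lia|rewrite det_vtx].
(* [hi] fails when [j.+1 - m] is less than half a turn. Otherwise [m >= 2] puts [j.-1] and [j.+1] at
   half a turn or beyond, and [lo] fails. *)
move=> hi; case: (ltnP (2 * (j.+1 - m)) n) => jmn.
  have s1 : 0 < sin (angle (j.+1 - m)) by apply: sin_angle_gt0; lia.
  have s0 : 0 <= sin (angle (j.-1 - m)) by apply: sin_angle_ge0; lia.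
  have := mulr_ge0 s0 (ltW zq); have := mulr_gt0 s1 qz; lra.
have s0 : sin (angle j.-1) <= 0 by apply: sin_angle_le0; lia.
have s1 : sin (angle j.+1) <= 0 by apply: sin_angle_le0; lia.
have := mulr_le0_ge0 s0 (ltW zq); have := mulr_le0_ge0 s1 (ltW qz).
(* One of the two sines is strictly negative: if [j.-1] is exactly half a turn, [n > 4] keeps [j.+1]
   short of a full turn. *)
case: (ltnP n (2 * j.-1)) => jn2.
  have s0' : sin (angle j.-1) < 0 by apply: sin_angle_lt0; lia.
  by have : sin (angle j.-1) * det z (vtx (t + j.+1)) < 0; [rewrite nmulr_rlt0|lra].
have s1' : sin (angle j.+1) < 0 by apply: sin_angle_lt0; lia.
by have : sin (angle j.+1) * det (vtx (t + j.-1)) z < 0; [rewrite nmulr_rlt0|lra].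
Qed.

Lemma angle1_lt : 0 < angle 1 < pi / 2.
Proof.
apply/andP; split; first exact: angle_gt0.
rewrite /angle ltr_pdivrMr // -mulrA ltr_pM2l ?pi_gt0 //.
by rewrite mulrC ltr_pdivlMr // -natrM ltr_nat; lia.
Qed.

Lemma vtx_next i : vtx (i + 1) =
  (cos (angle i) * cos (angle 1) - sin (angle i) * sin (angle 1),
   sin (angle i) * cos (angle 1) + cos (angle i) * sin (angle 1)).
Proof. by rewrite /vtx angleD cosD sinD. Qed.

Lemma vtx_prev i : vtx (i + n.-1) =
  (cos (angle i) * cos (angle 1) + sin (angle i) * sin (angle 1),
   sin (angle i) * cos (angle 1) - cos (angle i) * sin (angle 1)).
Proof.
have e : angle (i + n.-1) = angle i - angle 1 + pi *+ 2.
  by apply: (addIr (angle 1)); rewrite -angleD -addnA addn1 prednK // angleD anglen; ring.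
by rewrite /vtx e cosD2pi sinD2pi cosB sinB.
Qed.

(** By the addition formulas the two determinants in [near_vtx] add up to 2 sin(angle 1) times the
    inner product. *)
Lemma near_vtx_dot z q : 0 < near_vtx z q -> 0 < dot (vtx q) z.
Proof.
have /andP[a0 a1] := angle1_lt.
have s0 : 0 < sin (angle 1) by apply: sin_gt0_pihalf; rewrite a0.
rewrite near_vtx_gt0 vtx_prev vtx_next /det /dot /= => /andP[h1 h2].
rewrite -(pmulr_rgt0 _ s0); lra.
Qed.

(** Beating both neighbors confines z to the sector between the two bisectors around root q, which
    lies inside the open cone between the neighbors. *)
Lemma near_vtx_max z q : z != 0 ->
  dot (vtx (q + 1)) z <= dot (vtx q) z ->
  dot (vtx (q + n.-1)) z <= dot (vtx q) z -> 0 < near_vtx z q.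
Proof.
move=> z0; have /andP[a0 a1] := angle1_lt.
have s0 : 0 < sin (angle 1) by apply: sin_gt0_pihalf; rewrite a0.
have c0 : 0 < cos (angle 1) by apply: cos_gt0_pihalf; lra.
have := cos2Dsin2 (angle 1); have := cos2Dsin2 (angle q).
rewrite near_vtx_gt0 vtx_prev vtx_next /vtx.
move: (cos (angle q)) (sin (angle q)) => x y.
move: (cos _) (sin _) s0 c0 => c s s0 c0 xy1 cs1.
(* These are the coordinates of z in the orthonormal frame whose first vector is root q. The
   hypotheses become |s b| <= a(1-c), and the goals c|b| < s a. *)
pose a := x * z.1 + y * z.2; pose b := x * z.2 - y * z.1.
have c1 : c < 1 by nra.
have ab : 0 < a ^+ 2 + b ^+ 2.
  have -> : a ^+ 2 + b ^+ 2 = (x ^+ 2 + y ^+ 2) * dot z z by rewrite /a /b /dot; ring.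
  by rewrite xy1 mul1r dot_gt0.
rewrite [dot (x * c - _, _) z](_ : _ = c * a + s * b); last first.
  by rewrite /dot /a /b /=; ring.
rewrite [dot (x * c + _, _) z](_ : _ = c * a - s * b); last first.
  by rewrite /dot /a /b /=; ring.
rewrite [dot _ z](_ : _ = a) // => h1 h2.
rewrite [det (x * c + _, _) z](_ : _ = c * b + s * a); last first.
  by rewrite /det /a /b /=; ring.
rewrite [det z _](_ : _ = s * a - c * b); last by rewrite /det /a /b /=; ring.
(* The hypotheses add up to a(1-c) >= 0, so a <= 0 would force a = b = 0, hence z = 0. *)
have apos : 0 < a.
  rewrite ltNge; apply/negP => ale.
  have a1c : a * (1 - c) <= 0 by rewrite mulr_le0_ge0 //; lra.
  have sb : s * b = 0 by lra.
  have b0 : b = 0 by move/eqP: sb; rewrite mulf_eq0 gt_eqF //= => /eqP.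
  have : a * (1 - c) = 0 by lra.
  move/eqP; rewrite mulf_eq0 => /orP[/eqP aE|/eqP]; last by lra.
  by move: ab; rewrite aE b0 expr0n /= addr0 ltxx.
have key : 0 < a * (1 - c) by rewrite mulr_gt0 //; lra.
(* After multiplication by s the claim compares c a(1-c) with s^2 a, which exceeds it by a(1-c) >
   0. *)
rewrite -(pmulr_rgt0 (c * b + s * a) s0) -(pmulr_rgt0 (s * a - c * b) s0).
have e : s * s * a = a * (1 - c) + c * (a * (1 - c)).
  have -> : s * s = 1 - c ^+ 2 by rewrite -cs1; ring.
  by ring.
have u1 : c * (s * b) <= c * (a * (1 - c)) by rewrite ler_pM2l //; lra.
have u2 : - (c * (a * (1 - c))) <= c * (s * b).
  by rewrite -mulrN ler_pM2l //; lra.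
by apply/andP; split; lra.
Qed.

End RootsOfUnity.

(** * Complexes whose simplices are the vertex sets lying over short arcs *)

Section ArcComplex.
Variables (R : realType) (n m : nat) (V : finType) (K : scomplex V).
Variable p : V -> nat.
Hypotheses (n_gt4 : (4 < n)%N) (m_ge2 : (2 <= m)%N) (m_lt : (2 * m < n)%N).
Hypothesis p_surj : forall i, exists v, (p v = i %[mod n])%N.
Hypothesis KE : forall A : {set V}, A \in simplices K <->
  exists t, forall v, v \in A -> exists2 l, (l <= m)%N & (p v = t + l %[mod n])%N.

Local Notation vtx := (vtx R n).

Definition barycenter (x : V -> R) : R * R :=
  (\sum_v x v * (vtx (p v)).1, \sum_v x v * (vtx (p v)).2).

Lemma det_barycenter u x : det u (barycenter x) = \sum_v x v * det u (vtx (p v)).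
Proof.
rewrite /det /barycenter /= !mulr_sumr -sumrB; apply: eq_bigr => v _; ring.
Qed.

Lemma dot_barycenter x u : dot (barycenter x) u = \sum_v x v * dot (vtx (p v)) u.
Proof.
rewrite /dot /barycenter /= !mulr_suml -big_split /=; apply: eq_bigr => v _; ring.
Qed.

Lemma convex_sum_gt0 (x c : V -> R) : (forall v, 0 <= x v) -> \sum_v x v = 1 ->
  (forall v, x v != 0 -> 0 < c v) -> 0 < \sum_v x v * c v.
Proof.
move=> x0 x1 c0.
have xc v : 0 <= x v * c v.
  by have [->|/c0/ltW ?] := eqVneq (x v) 0; [rewrite mul0r|exact: mulr_ge0].
rewrite lt_neqAle sumr_ge0 ?andbT // eq_sym; apply: contra_eqN x1 => s0.
rewrite big1 => [|v _]; first by rewrite eq_sym oner_eq0.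
apply/eqP; apply: contraTT s0 => xv; rewrite psumr_neq0 //; apply/hasP.
by exists v; rewrite ?mem_index_enum //= mulr_gt0 ?c0 // lt_neqAle eq_sym xv x0.
Qed.

(** The arc spans less than half a turn, so its roots have nonnegative determinants with both ends,
    and so do their convex combinations. No root equals both ends, so the sum of the two
    determinants is positive, which keeps the barycenter off the origin. *)
Lemma barycenter_arc (x : V -> R) : barycentric K x -> exists t,
  [/\ forall v, x v != 0 -> exists2 l, (l <= m)%N & (p v = t + l %[mod n])%N,
      0 <= det (vtx t) (barycenter x), 0 <= det (barycenter x) (vtx (t + m))
    & barycenter x != 0].
Proof.
move=> [x0 x1 /KE[t xt]].
have xA v : x v != 0 -> exists2 l, (l <= m)%N & (p v = t + l %[mod n])%N.
  by move=> xv; apply: xt; rewrite finset.inE.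
have lo v l : (l <= m)%N -> (p v = t + l %[mod n])%N ->
  det (vtx t) (vtx (p v)) = sin (angle R n l).
  by move=> lm /(vtx_eqmod R n_gt4) ->; rewrite det_vtx.
have hi v l : (l <= m)%N -> (p v = t + l %[mod n])%N ->
  det (vtx (p v)) (vtx (t + m)) = sin (angle R n (m - l)).
  move=> lm /(vtx_eqmod R n_gt4) ->.
  by have -> : (t + m = t + l + (m - l))%N; [lia|rewrite det_vtx].
exists t; split => //.
- rewrite det_barycenter sumr_ge0 // => v _.
  have [->|/xA[l lm pv]] := eqVneq (x v) 0; first by rewrite mul0r.
  by rewrite mulr_ge0 // (lo v l) // sin_angle_ge0 //; lia.
- rewrite detC det_barycenter -sumrN sumr_ge0 // => v _.
  have [->|/xA[l lm pv]] := eqVneq (x v) 0; first by rewrite mul0r oppr0.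
  by rewrite -mulrN -detC mulr_ge0 // (hi v l) // sin_angle_ge0 //; lia.
- apply/eqP => c0.
  have : det (vtx t) (barycenter x) - det (vtx (t + m)) (barycenter x) = 0.
    by rewrite c0 /det /=; ring.
  rewrite !det_barycenter -sumrB => s0.
  suff : 0 < \sum_v x v * (det (vtx t) (vtx (p v)) + det (vtx (p v)) (vtx (t + m))).
    rewrite (eq_bigr (fun v => x v * det (vtx t) (vtx (p v)) -
      x v * det (vtx (t + m)) (vtx (p v)))) ?s0 ?ltxx // => v _.
    by rewrite [det (vtx (p v)) _]detC; ring.
  apply: convex_sum_gt0 => // v /xA[l lm pv]; rewrite (lo v l) // (hi v l) //.
  case: (posnP l) => l0.
    by apply: ltr_wpDl; [apply: sin_angle_ge0|apply: sin_angle_gt0]; lia.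
  by apply: ltr_pwDl; [apply: sin_angle_gt0|apply: sin_angle_ge0]; lia.
Qed.

(** A root maximizing the inner product with [z] beats its two neighbors; [p_surj] makes the maximum
    over [V] range over all roots. *)
Lemma near_vtx_exists (z : R * R) : z != 0 -> exists v, 0 < near_vtx n z (p v).
Proof.
move=> z0; have [v0 _] := p_surj 0.
pose v := [arg max_(w > v0) dot (vtx (p w)) z]%O.
have vmax i : dot (vtx i) z <= dot (vtx (p v)) z.
  have [w /(vtx_eqmod R n_gt4) <-] := p_surj i.
  by rewrite /v; case: arg_maxP => // u _; apply.
by exists v; apply: near_vtx_max.
Qed.

Definition weight (z : R * R) (v : V) : R :=
  near_vtx n z (p v) / \sum_u near_vtx n z (p u).

Lemma sum_near_gt0 (z : R * R) : z != 0 -> 0 < \sum_v near_vtx n z (p v).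
Proof.
move=> /near_vtx_exists[v zv]; rewrite (bigD1 v) //=.
by apply: ltr_pwDl => //; apply: sumr_ge0 => u _; exact: near_vtx_ge0.
Qed.

Lemma weight_neq0 z v : weight z v != 0 -> 0 < near_vtx n z (p v).
Proof.
move=> h; rewrite lt_neqAle near_vtx_ge0 andbT eq_sym.
by apply: contraNneq h => e; rewrite /weight e mul0r.
Qed.

Lemma weight_barycentric z : z != 0 -> barycentric K (weight z).
Proof.
move=> z0; have s0 := sum_near_gt0 z0; split.
- by move=> v; rewrite divr_ge0 ?near_vtx_ge0 // ltW.
- by rewrite -mulr_suml divff // gt_eqF.
(* [z] lies in the cone between the neighbors of [p u], so every charged root lies in the arc of
   length 2 centered at [p u], which fits in one of length [m]. *)
- have [u zu] := near_vtx_exists z0; apply/KE; exists (p u + n.-1)%N => v.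
  rewrite finset.inE => /weight_neq0 zv.
  have [|||l l2 pv] := @near_vtx_arc R n n_gt4 (p u + n.-1) 2 z (p v) _ _ _ zv.
  + by [].
  + by move: zu; rewrite near_vtx_gt0 => /andP[/ltW].
  + move: zu; rewrite near_vtx_gt0 => /andP[_ /ltW].
    congr (0 <= det z _); apply: (vtx_eqmod R n_gt4).
    by have -> : (p u + n.-1 + 2 = p u + 1 + n)%N; [lia|rewrite modnDr].
  + by exists l => //; apply: leq_trans m_ge2.
Qed.

Lemma cts_near_vtx (X : topologicalType) (F : X -> R * R) q :
  continuous F -> continuous (fun x => near_vtx n (F x) q).
Proof.
have cst (c : R) : continuous (fun _ : X => c) by move=> x; exact: cvg_cst.
move=> cF; apply: cts_max => //; apply: cts_min; rewrite /det.
- by apply: ctsB; apply: ctsM => //; [exact: cts_snd|exact: cts_fst].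
- by apply: ctsB; apply: ctsM => //; [exact: cts_fst|exact: cts_snd].
Qed.

Lemma arc_complex_circle : homotopy_equivalent R (geom_realization R K) (circle R).
Proof.
have circle_neq0 (z : circle R) : val z != 0.
  by apply/eqP => z0; have := set_valP z; rewrite z0 /= expr0n /= addr0 => /esym/eqP;
     rewrite oner_eq0.
have barycenter_neq0 (x : geom_realization R K) : barycenter (val x) != 0.
  by have [t []] := barycenter_arc (set_valP x).
have cst (X : topologicalType) (c : R) : continuous (fun _ : X => c).
  by move=> x; exact: cvg_cst.
have cid (X : topologicalType) : continuous (fun x : X => x) by move=> x; exact: cvg_id.
have [f cf fE] : exists2 f : geom_realization R K -> circle R,
    continuous f & forall x, val (f x) = unitv (barycenter (val x)).
  apply: lift_set_type => [|x]; last exact: unitv_circle.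
  apply: cts_unitv => //.
  have cv v : continuous (fun x : geom_realization R K => val x v).
    by apply: (cts_eval (F := fun x : geom_realization R K => val x)); exact: cts_val.
  by apply: cts_pair; apply: cts_sum => v; apply: ctsM.
have [g cg gE] : exists2 g : circle R -> geom_realization R K,
    continuous g & forall z, val (g z) = weight (val z).
  apply: lift_set_type => [|z]; last exact: weight_barycentric.
  have cn v : continuous (fun z : circle R => near_vtx n (val z) (p v)).
    by apply: cts_near_vtx; exact: cts_val.
  apply: cts_ptws => v; apply: ctsM => //.
  by apply: ctsV => [|z]; [exact: cts_sum|rewrite gt_eqF ?sum_near_gt0].
exists f, g; split => //.
- apply: homotopic_realization => //.
    by move=> x; apply: continuous_comp; [exact: cf|exact: cg].
  (* Normalization keeps the signs of determinants, so the arc containing the support of [x] also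
     contains that of [g (f x)]. *)
  move=> x; have [t [xt lo hi c0]] := barycenter_arc (set_valP x).
  apply/KE; exists t => v; rewrite finset.inE => /orP[|]; last exact: xt.
  rewrite /= gE => /weight_neq0.
  apply: near_vtx_arc => //; rewrite fE.
    by rewrite detC det_unitv -mulNr -detC divr_ge0 ?sqrtr_ge0.
  by rewrite det_unitv divr_ge0 ?sqrtr_ge0.
- apply: homotopic_circle => //.
    by move=> z; apply: continuous_comp; [exact: cg|exact: cf].
  move=> z; rewrite /= fE dot_unitv divr_gt0 ?norm_gt0 // dot_barycenter.
  have [w0 w1 _] := set_valP (g z); apply: convex_sum_gt0 => // v.
  by rewrite gE => /weight_neq0/near_vtx_dot; apply.
Qed.

End ArcComplex.

(** * Dimension, regularity and the arcs of the neighborhood complex *)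

Lemma sc_dim_neighborhood (H : sgraph) (d : nat) (v : H) : regular H d ->
  sc_dim (neighborhood_complex H) = d%:Z - 1.
Proof.
move=> Hd; congr (Posz _ - 1); apply/eqP; rewrite eqn_leq; apply/andP; split.
  apply/bigmax_leqP => A; rewrite finset.inE => /existsP[w /forall_inP Aw].
  by rewrite -(Hd w); apply: subset_leq_card; apply/fintype.subsetP => u /Aw.
(* The full neighborhood of [v] is a simplex that attains the bound. *)
pose N : {set H} := [set w | adj v w]%SET.
have -> : d = #|N| by rewrite -(Hd v) cardsE.
apply: leq_bigmax_cond; rewrite finset.inE; apply/existsP; exists v.
by apply/forall_inP => w; rewrite finset.inE.
Qed.

Lemma regular_indep_graph (k : nat) : (2 <= k)%N ->
  regular (induced_indep_graph (squared_cycle (3 * k + 1)) k) (k + 2).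
Proof.
move=> k2 v; have [i <-] := iset_surj k2 v.
(* [s] enumerates the neighbors of [iset k2 i], injectively since k+2 <= 3k+1. *)
pose s (l : 'I_(k + 2)) := iset k2 (residue k (i + (k + l))).
have s_inj : injective s.
  move=> a b /iset_inj/eqP; rewrite residue_eq !eqn_modDl !modn_small.
  - by move/eqP/val_inj.
  - by have := ltn_ord b; lia.
  - by have := ltn_ord a; lia.
rewrite -[RHS]card_ord -(card_codom s_inj); apply: eq_card => w.
rewrite inE; have [j <-] := iset_surj k2 w; apply/idP/codomP.
  move/adj_iset => [l lk jl]; exists (Ordinal lk); congr iset.
  by apply/eqP; rewrite -[j]residueK residue_eq jl.
by move=> [l ->]; apply/adj_iset; exists l; rewrite //= modn_mod.
Qed.

Theorem theorem4p8 (R : realType) (k : nat) (hk : (3 <= k)%N) :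
  let H := induced_indep_graph (squared_cycle (3 * k + 1)) k in
  [/\ regular H (k + 2),
      sc_dim (neighborhood_complex H) = Posz (k + 1)
    & homotopy_equivalent R
        (geom_realization R (neighborhood_complex H)) (circle R)].
Proof.
move=> H; have k2 : (2 <= k)%N by lia.
have Hreg : regular H (k + 2) := regular_indep_graph k2.
split => //; first by rewrite (sc_dim_neighborhood (iset k2 (residue k 0)) Hreg); lia.
have [p pK] : exists p : H -> 'I_(3 * k + 1), forall v, iset k2 (p v) = v.
  by exists (fun v => sval (cid (iset_surj k2 v))) => v; case: cid.
have p_surj i : exists v, (p v = i %[mod 3 * k + 1])%N.
  exists (iset k2 (residue k i)).
  by rewrite (iset_inj (pK _)) /= modn_mod.
(* An arc of k+2 residues has length m = k+1, and 2(k+1) < 3k+1. *)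
apply: (@arc_complex_circle R (3 * k + 1) (k + 1) H _ p); try lia; first exact: p_surj.
move=> A; rewrite finset.inE; split=> [/existsP[w /forall_inP Aw]|[t At]].
  exists (p w + k)%N => v /Aw; rewrite -{1}[w]pK -[v in adj _ v]pK => /adj_iset[l lk pv].
  by exists l; [lia|rewrite -addnA].
(* The arc starting at t is the neighborhood of t-k, which is t + (2k+1) modulo 3k+1. *)
have [w pw] := p_surj (t + (2 * k + 1))%N.
apply/existsP; exists w; apply/forall_inP => v /At[l lk pv].
rewrite -[w]pK -[v]pK; apply/adj_iset; exists l; first by lia.
rewrite pv -[RHS]modnDml pw modnDml.
have -> : (t + (2 * k + 1) + (k + l) = t + l + (3 * k + 1))%N by lia.
by rewrite modnDr.
Qed.
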